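(* Let $(X,T)$ be a minimal topological dynamical system. Then $(X,T)$ is frequently stable if and only if it is almost automorphic.
   Context: A topological dynamical system (t.d.s.) is a pair $(X,T)$ where $X$ is a (nonempty) compact metric space with metric $d$ and $T:X\to X$ is a continuous map (not assumed invertible). It is minimal if $X$ contains no proper nonempty closed invariant subset (equivalently, every forward orbit $\{x,Tx,T^2x,\dots\}$ is dense in $X$). $\mathbb{Z}_+$ denotes the set of non-negative integers. For $F\subset\mathbb{Z}_+$ the upper density is $\overline{D}(F)=\limsup_{N\to\infty}\frac{|F\cap[0,N-1]|}{N}$. For $x\in X$ and $\delta>0$ put $B_\delta(x)=\{y\in X: d(x,y)<\delta\}$. A point $x\in X$ is frequently stable if for every $\epsilon>0$ there is $\delta>0$ such that $\overline{D}(\{i\in\mathbb{Z}_+:\operatorname{diam}(T^iB_\delta(x))>\epsilon\})<1$. The system $(X,T)$ is frequently stable if all points of $X$ are frequently stable. A t.d.s. $(X,T)$ is equicontinuous if for every $\epsilon>0$ there is $\delta>0$ such that $d(x,y)<\delta$ implies $d(T^nx,T^ny)<\epsilon$ for all $n\in\mathbb{Z}_+$. A factor map $\pi:(X,T)\to(Y,S)$ between t.d.s. is a continuous surjection with $\pi\circ T=S\circ\pi$. There is a smallest closed $T$-invariant equivalence relation $S_{eq}$ on $X$ such that the quotient system on $X_{eq}=X/S_{eq}$ is equicontinuous; the quotient system $(X_{eq},T_{eq})$ is the maximal equicontinuous factor of $(X,T)$, with quotient factor map $\pi_{eq}:X\to X_{eq}$. A factor map $\pi:X\to Y$ is almost $1$-$1$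 if $\{x\in X:\pi^{-1}(\pi(x))=\{x\}\}$ is residual (that is, it is a countable intersection of dense open subsets of $X$). The system $(X,T)$ is almost automorphic if $\pi_{eq}$ is almost $1$-$1$. *)

(* Defs.v *)
From HB Require Import structures.
From mathcomp Require Import all_boot all_order all_algebra.
From mathcomp Require Import all_classical all_reals all_analysis.
From mathcomp Require Import borel_hierarchy.

Set Implicit Arguments.
Unset Strict Implicit.
Unset Printing Implicit Defensive.

Import Order.TTheory GRing.Theory Num.Theory.
Import numFieldTopology.Exports.

Local Open Scope classical_set_scope.
Local Open Scope ring_scope.
Local Open Scope quotient_scope.

Definition is_tds (X : topologicalType) (T : X -> X) : Prop :=
  [/\ [set: X] !=set0, compact [set: X] & continuous T].

Definition minimal (X : topologicalType) (T : X -> X) : Prop :=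
  forall A : set X, closed A -> A !=set0 -> T @` A `<=` A -> A = [set: X].

Definition upper_density (R : realType) (F : set nat) : \bar R :=
  limn_esup (fun N : nat => (#|[pred i : 'I_N | `[< F i >]]|%:R / N%:R : R)%:E).

Definition diam (R : realType) (X : metricType R) (A : set X) : \bar R :=
  ereal_sup [set (mdist p.1 p.2)%:E | p in A `*` A].

Definition frequently_stable_at (R : realType) (X : metricType R)
    (T : X -> X) (x : X) : Prop :=
  forall eps : R, 0 < eps -> exists2 delta : R, 0 < delta &
    (upper_density R
       [set i : nat | eps%:E < diam (iter i T @` ball x delta)] < 1)%E.

Definition frequently_stable (R : realType) (X : metricType R)
    (T : X -> X) : Prop :=
  forall x : X, frequently_stable_at T x.

Definition metrizes (R : realType) (Y : topologicalType) (d : Y -> Y -> R) :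
    Prop :=
  [/\ forall x y, d x y = 0 <-> x = y,
      forall x y, d x y = d y x,
      forall x y z, d x z <= d x y + d y z
    & forall (x : Y) (A : set Y), nbhs x A <->
        exists2 e : R, 0 < e & [set y | d x y < e] `<=` A].

(* On a compact space all compatible metrics are uniformly equivalent, so the
   choice of the metric is immaterial; a quotient carries no preferred one. *)
Definition equicontinuous_tds (R : realType) (Y : topologicalType)
    (S : Y -> Y) : Prop :=
  exists2 d : Y -> Y -> R, metrizes d &
    forall eps : R, 0 < eps -> exists2 delta : R, 0 < delta &
      forall x y : Y, d x y < delta ->
        forall n : nat, d (iter n S x) (iter n S y) < eps.

Definition closed_invariant (X : topologicalType) (T : X -> X)
    (E : equiv_rel X) : Prop :=
  closed [set p : X * X | E p.1 p.2] /\
  forall x y : X, E x y -> E (T x) (T y).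

Definition quot (X : topologicalType) (E : equiv_rel X) : topologicalType :=
  quotient_topology {eq_quot E}.

Definition quot_pi (X : topologicalType) (E : equiv_rel X) (x : X) : quot E :=
  \pi_{eq_quot E} x.

(* The induced map, computed on representatives; quot_mapE shows that it does
   not depend on them when E is T-invariant. *)
Definition quot_map (X : topologicalType) (E : equiv_rel X) (T : X -> X)
    (q : quot E) : quot E :=
  quot_pi E (T (repr (q : {eq_quot E}))).

Lemma quot_mapE (X : topologicalType) (E : equiv_rel X) (T : X -> X) :
  (forall x y, E x y -> E (T x) (T y)) ->
  forall x, quot_map T (quot_pi E x) = quot_pi E (T x).
Proof.
move=> TE x; apply/eqmodP/TE.
by apply/eqmodP; rewrite reprK.
Qed.

Definition equicontinuous_quotient (R : realType) (X : topologicalType)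
    (T : X -> X) (E : equiv_rel X) : Prop :=
  closed_invariant T E /\ equicontinuous_tds R (@quot_map X E T).

(* E is the relation S_eq of the maximal equicontinuous factor; being the least
   element of a family it is unique. *)
Definition is_Seq (R : realType) (X : topologicalType) (T : X -> X)
    (E : equiv_rel X) : Prop :=
  equicontinuous_quotient R T E /\
  forall E' : equiv_rel X, equicontinuous_quotient R T E' ->
    forall x y : X, E x y -> E' x y.

Definition almost_one_to_one (X Y : topologicalType) (f : X -> Y) : Prop :=
  Gdelta_dense [set x : X | f @^-1` [set f x] = [set x]].

Definition almost_automorphic (R : realType) (X : topologicalType)
    (T : X -> X) : Prop :=
  exists2 E : equiv_rel X, is_Seq R T E & almost_one_to_one (quot_pi E).

(* Main.v *)
(* For the forward implication, fix an invariant mean on the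
   subsets of the time axis and a nonempty open set U, and let f(P) be the outer
   regularised frequency of the times i at which T^i U meets P. By minimality
   the upper semicontinuous function x |-> f({x}) is a constant c, and
   f({x, y}) - c is a continuous pseudometric which T does not expand (the
   argument of McMahon for the regionally proximal relation); being strongly
   subadditive, f yields the triangle inequality. For some K every
   T^i U contains one of the points T^j x0 with j <= K, so when
   diam (T^i U) is small with positive frequency one of these points has a small
   fibre. A supremum over a sequence of such sets U gives an equicontinuous
   factor whose fibres of small diameter are dense. Its fibres are proximal,
   while equicontinuous minimal systems are distal, hence it is the maximal one.
   Conversely, near a singleton fibre small balls of the factor have preimages of
   small diameter, and all orbits visit them at a syndetic set of times. *)
Require Import Defs.
From mathcomp Require Import all_boot all_order all_algebra.
From mathcomp Require Import all_classical all_reals all_analysis.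
From mathcomp Require Import borel_hierarchy lra zify.

Set Implicit Arguments.
Unset Strict Implicit.
Unset Printing Implicit Defensive.

Import Order.TTheory GRing.Theory Num.Theory.
Import numFieldTopology.Exports numFieldNormedType.Exports.

Local Open Scope classical_set_scope.
Local Open Scope ring_scope.
Local Open Scope quotient_scope.

(** * Densities and an invariant mean *)

Section Density.
Context {R : realType}.
Implicit Types F G : set nat.

Definition count_below F (N : nat) : nat := #|[pred i : 'I_N | `[< F i >]]|.

Lemma count_below_sum F N : count_below F N = (\sum_(i < N) `[< F i >])%N.
Proof.
rewrite /count_below -sum1_card big_mkcond /=; apply: eq_bigr => i _.
by rewrite unfold_in /=; case: `[< _ >].
Qed.

Lemma count_below_le F N : (count_below F N <= N)%N.
Proof. by apply: leq_trans (max_card _) _; rewrite card_ord. Qed.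

Lemma count_below_subset F G N :
  F `<=` G -> (count_below F N <= count_below G N)%N.
Proof.
move=> FG; rewrite /count_below; apply: subset_leq_card; apply/fintype.subsetP => i.
by rewrite !unfold_in /= => /asboolP Fi; apply/asboolP/FG.
Qed.

Lemma count_belowUI F G N :
  (count_below (F `|` G) N + count_below (F `&` G) N =
   count_below F N + count_below G N)%N.
Proof.
rewrite !count_below_sum -!big_split /=; apply: eq_bigr => i _.
by rewrite asbool_or asbool_and; case: `[< F i >]; case: `[< G i >].
Qed.

Lemma count_below_succ F N :
  (count_below F N <= (count_below (succn @` F) N).+1)%N /\
  (count_below (succn @` F) N <= count_below F N)%N.
Proof.
have succF i : `[< (succn @` F) i.+1 >] = `[< F i >].
  by apply/asbool_equiv_eq; split=> [[j Fj [<-]]//|Fi]; exists i.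
have succF0 : `[< (succn @` F) 0%N >] = false.
  by apply/asboolPn => -[].
case: N => [|N]; first by rewrite !count_below_sum !big_ord0.
rewrite !count_below_sum big_ord_recr big_ord_recl /= succF0 add0n.
under [X in (_ <= X.+1)%N /\ (X <= _)%N]eq_bigr => i _ do rewrite succF.
by case: `[< F N >]; rewrite ?addn1 ?addn0 leqnn ?leqnSn.
Qed.

Definition density_below F (N : nat) : R := (count_below F N)%:R / N%:R.

Lemma density_below_itv F N : `[0, 1]%classic (density_below F N).
Proof.
rewrite /= in_itv /= /density_below divr_ge0 //=.
have [->|N0] := posnP N; first by rewrite invr0 mulr0.
by rewrite ler_pdivrMr ?ltr0n// mul1r ler_nat count_below_le.
Qed.

Lemma upper_density_lt1 F : (upper_density R F < 1)%E <->
  exists2 r : R, r < 1 & \forall N \near \oo, density_below F N <= r.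
Proof.
rewrite /upper_density /limn_esup /limf_esup; split.
  move=> /ereal_inf_lt[_ [A Aoo <-]] sA1.
  have [r /andP[sr r1]] : exists r : R,
      (ereal_sup [set (density_below F N)%:E | N in A] <= r%:E)%E && (r < 1).
    move: sA1; rewrite -[X in ereal_sup X]/[set (density_below F N)%:E | N in A].
    (* The value +oo contradicts the bound, and for -oo any real below 1 serves. *)
    case: ereal_sup => [r|//|_]; last by exists 0; rewrite leNye /=.
    by rewrite lte_fin => r1; exists r; rewrite lexx.
  exists r => //; apply: filterS Aoo => N AN; rewrite -lee_fin.
  by apply: le_trans sr; apply: ereal_sup_ubound; exists N.
move=> [r r1 Fr]; apply: (@le_lt_trans _ _ r%:E); last by rewrite lte_fin.
apply: (@le_trans _ _ (ereal_sup
    [set (density_below F N)%:E | N in [set N | density_below F N <= r]])).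
  by apply: ereal_inf_lbound; exists [set N | density_below F N <= r].
by apply: ge_ereal_sup => _ [N /= FN <-]; rewrite lee_fin.
Qed.

(* The mean is the limit of the densities along a free ultrafilter. *)
Lemma invariant_mean : exists m : set nat -> R,
  [/\ forall F G, F `<=` G -> m F <= m G,
      forall F G, m (F `|` G) + m (F `&` G) = m F + m G,
      forall F, m (succn @` F) = m F,
      m set0 = 0 /\ m setT = 1
    & forall F, (upper_density R F < 1)%E -> m F < 1].
Proof.
have [U [UU ooU]] := ultraFilterLemma (_ : ProperFilter (@nbhs nat _ \oo)).
have UP : ProperFilter U by exact: ultra_proper.
have cvgU F : cvg (density_below F N @[N --> U]).
  have F01 : U (density_below F @^-1` `[0, 1]%classic).
    by apply: filterE => N; exact: density_below_itv.
  have [p [_ clp]] := @segment_compact R 0 1 (density_below F @ U) _ F01.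
  apply/cvg_ex; exists p => V pV.
  (* An ultrafilter omitting the preimage of [V] contains that of the complement, which is
     impossible as [V] is a neighbourhood of the cluster point [p]. *)
  have [//|UV] := in_ultra_setVsetC (density_below F @^-1` V) UU.
  by have [x []] := clp (~` V) V UV pV.
pose m F := lim (density_below F N @[N --> U]).
have mE F l : density_below F @ U --> l -> m F = l by exact: cvg_lim.
have cvgc (r : R) (f : nat -> R) : (\forall N \near \oo, f N = r) ->
    f N @[N --> U] --> r.
  by move=> fr; apply: cvg_near_cst; exact: ooU.
exists m; split.
- move=> F G FG; apply: ler_lim => //; apply: nearW => N.
  by rewrite ler_wpM2r ?invr_ge0// ler_nat count_below_subset.
- move=> F G; have -> : m (F `|` G) = m F + m G - m (F `&` G).
    apply: mE; have -> : density_below (F `|` G) =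
        density_below F + density_below G - density_below (F `&` G).
      apply/funext => N; rewrite !fctE /density_below -mulrDl -mulrBl.
      by rewrite -natrD -count_belowUI natrD addrK.
    by apply: cvgB; [apply: cvgD; exact: cvgU|exact: cvgU].
  by rewrite subrK.
- move=> F; apply: mE.
  have -> : density_below (succn @` F) =
      density_below F + (density_below (succn @` F) - density_below F).
    by rewrite addrC subrK.
  rewrite -[X in _ --> X]addr0; apply: cvgD; first exact: cvgU.
  suff d0 : (density_below (succn @` F) - density_below F) @ \oo --> (0 : R).
    by move=> V /d0 /ooU.
  (* [harmonic n] is 1/(n+1), hence the shift; the two counts differ by at most 1. *)
  rewrite -cvg_shiftS; apply: norm_cvg0.
  apply: (@squeeze_cvgr _ _ _ _ (fun=> 0) (@harmonic R)).
  + apply: nearW => N; rewrite normr_ge0 /= !fctE /density_below -mulrBl.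
    rewrite normrM normfV (ger0_norm (ler0n _ _)) ler_piMl ?invr_ge0//.
    have [] := count_below_succ F N.+1.
    move: (count_below _ _) (count_below _ _) => a b ab ba.
    rewrite distrC ger0_norm ?subr_ge0 ?ler_nat// lerBlDr.
    by rewrite addrC natr1 ler_nat.
  + exact: cvg_cst.
  + exact: cvg_harmonic.
- split.
    apply: mE; apply: cvgc; apply: nearW => N.
    rewrite /density_below count_below_sum big1 ?mul0r// => i _.
    by rewrite asboolF.
  apply: mE; apply: cvgc; exists 1%N => // N /= N1.
  rewrite /density_below count_below_sum.
  under eq_bigr do rewrite asboolT//.
  by rewrite sum1_card card_ord divff// pnatr_eq0 -lt0n.
- move=> F /upper_density_lt1[r r1 Fr]; apply: le_lt_trans r1.
  by apply: limr_le; [exact: cvgU|exact: ooU].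
Qed.

(** Each window of K+1 consecutive times contains one outside [F], so the count below N falls short
    of N by at least N/(K+1), rounded down. *)
Lemma upper_density_syndeticC F (K : nat) :
  (forall n, exists2 k, (k <= K)%N & ~ F (n + k)%N) ->
  (upper_density R F < 1)%E.
Proof.
move=> FK.
have step N : (count_below F (N + K.+1) <= count_below F N + K)%N.
  rewrite !count_below_sum big_split_ord /= leq_add2l.
  have [k kK nFk] := FK N.
  rewrite (bigD1 (Ordinal (kK : (k < K.+1)%N))) //= asboolF// add0n.
  apply: (@leq_trans (\sum_(i < K.+1 | i != Ordinal (kK : (k < K.+1)%N)) 1)).
    by apply: leq_sum => i _; case: `[< _ >].
  by rewrite sum1_card cardC1 card_ord.
have bound q s : (count_below F (s + q * K.+1) + q <= s + q * K.+1)%N.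
  elim: q => [|q IHq]; first by rewrite !addn0 count_below_le.
  by have := step (s + q * K.+1)%N; rewrite mulSnr addnA; lia.
(* The factor 2 absorbs the rounding: the integer quotient of N by K+1 exceeds N/(2(K+1)) once N is
   at least K+1. *)
apply/upper_density_lt1; exists (1 - (2 * K.+1)%:R^-1).
  by rewrite ltrBlDr ltrDl invr_gt0 ltr0n.
exists K.+1 => // N /= KN.
have := bound (N %/ K.+1)%N (N %% K.+1)%N.
rewrite [(_ + _ * _)%N]addnC -divn_eq.
have : (N < 2 * K.+1 * (N %/ K.+1))%N.
  have q0 : (0 < N %/ K.+1)%N by rewrite divn_gt0.
  by move: (ltn_ceil N (ltn0Sn K)) (leq_pmull K.+1 q0); lia.
move: (N %/ _)%N => q Nq cqN.
have N0 : (0 < N)%N by lia.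
rewrite /density_below ler_pdivrMr ?ltr0n// mulrBl mul1r lerBrDr.
apply: (@le_trans _ _ (count_below F N + q)%:R); last by rewrite ler_nat.
by rewrite natrD lerD2l ler_pdivrMl ?ltr0n// -natrM ler_nat ltnW.
Qed.

End Density.

(** * Minimal systems *)

(** Takes the place of convergent subsequences in the compactness arguments below. *)
Lemma compact_seq_cluster (Y : topologicalType) (u : nat -> Y) :
  compact [set: Y] ->
  exists p : Y, forall V, nbhs p V -> forall n0, exists2 n, (n0 <= n)%N & V (u n).
Proof.
move=> cY; have [p [_ clp]] := cY (u @ \oo) _ filterT.
exists p => V pV n0; have [||y [[n /= n0n <-] Vn]] := clp (u @` [set n | n0 <= n]%N) V.
- by exists n0 => // n /= n0n; exists n.
- exact: pV.
- by exists n.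
Qed.

Section Dynamics.
Context {X : topologicalType} (T : X -> X).

Lemma iter_continuous n : continuous T -> continuous (iter n T).
Proof.
move=> cT; elim: n => [|n IHn] x; first exact: cvg_id.
by apply: continuous_comp; [exact: IHn|exact: cT].
Qed.

(** The points whose orbit avoids [U] form a closed invariant set, which is not all of X because it
    misses [U]. *)
Lemma minimal_orbit (U : set X) x :
  continuous T -> minimal T -> open U -> U !=set0 -> exists n, U (iter n T x).
Proof.
move=> cT mT oU [u Uu]; apply: contrapT => nU.
pose A := ~` \bigcup_n (iter n T @^-1` U).
have : A = setT.
  apply: mT.
  - apply: open_closedC; apply: bigcup_open => n _.
    by apply: open_comp => // y _; exact: iter_continuous.
  - by exists x => -[n _ Un]; apply: nU; exists n.
  - move=> _ [y Ay <-] [n _ Un]; apply: Ay; exists n.+1 => //.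
    by rewrite /preimage /= -iterSr in Un *.
by move/seteqP => [_ /(_ u I)]; apply; exists 0%N.
Qed.

(** Otherwise points avoiding [U] for longer and longer times cluster at a point whose whole orbit
    avoids [U]. *)
Lemma minimal_syndetic (U : set X) :
  compact [set: X] -> continuous T -> minimal T -> open U -> U !=set0 ->
  exists K, forall x, exists2 k, (k <= K)%N & U (iter k T x).
Proof.
move=> cX cT mT oU U0; apply: contrapT => nK.
have /choice[u uP] K : exists x, forall k, (k <= K)%N -> ~ U (iter k T x).
  apply: contrapT => nx; apply: nK; exists K => x; apply: contrapT => nk.
  by apply: nx; exists x => k kK Uk; apply: nk; exists k.
have [p clp] := compact_seq_cluster u cX.
have [n Un] := minimal_orbit p cT mT oU U0.
have [|N nN UN] := clp (iter n T @^-1` U) _ n.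
  by apply: iter_continuous => //; exact: open_nbhs_nbhs.
exact: uP nN UN.
Qed.

Lemma minimal_surjective : hausdorff_space X -> is_tds T -> minimal T ->
  forall y, exists x, T x = y.
Proof.
move=> hX [[x _] cX cT] mT y.
have : range T = setT.
  apply: mT; last by move=> _ [z _ <-]; exists z.
  - apply: compact_closed => //; apply: continuous_compact => //.
    exact: continuous_subspaceT.
  - by exists (T x); exists x.
by move/seteqP => [_ /(_ y I)][z _ <-]; exists z.
Qed.

Lemma iter_surjective n : (forall y, exists x, T x = y) ->
  forall y, exists x, iter n T x = y.
Proof.
move=> sT; elim: n => [|n IHn] y; first by exists y.
by have [z <-] := sT y; have [x <-] := IHn z; exists x.
Qed.

End Dynamics.

(** * Equicontinuous pseudometrics are distal *)

Lemma harmonic_lt (R : realType) (k : R) :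
  0 < k -> \forall n \near \oo, harmonic n < k.
Proof.
by move=> k0; have /cvgrPdist_lt/(_ k k0) := @cvg_harmonic R; apply: filterS => n;
  rewrite sub0r normrN ger0_norm ?harmonic_ge0.
Qed.

Section Pseudometric.
Context {R : realType} {X : topologicalType}.

(** With the triangle inequality the last clause makes [e] continuous on the product; the classes of
    points at distance 0 play the role of fibres. *)
Definition pseudometric (e : X -> X -> R) :=
  [/\ forall x, e x x = 0,
      forall x y, e x y = e y x,
      forall y x z, e x z <= e x y + e y z
    & forall x k, 0 < k -> nbhs x [set y | e x y < k]].

Definition equicontinuous_for (T : X -> X) (e : X -> X -> R) :=
  forall eps, 0 < eps -> exists2 delta, 0 < delta &
    forall x y, e x y < delta -> forall n, e (iter n T x) (iter n T y) < eps.

Context {e : X -> X -> R} (pe : pseudometric e).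

Lemma pseudometric_ge0 x y : 0 <= e x y.
Proof. by have [exx es et _] := pe; have := et y x x; rewrite exx (es y x); lra. Qed.

Lemma open_pseudoball x k : open [set y | e x y < k].
Proof.
have [_ _ et en] := pe; rewrite openE => y /= xyk.
have := en y (k - e x y); rewrite subr_gt0 => /(_ xyk); apply: filterS => z /= yz.
by have := et y x z; lra.
Qed.

Lemma closed_pseudometric_eq0 : closed [set p : X * X | e p.1 p.2 = 0].
Proof.
have [_ es et en] := pe.
rewrite -[X in closed X]setCK; apply: open_closedC; rewrite openE => -[x y] /= xy.
have k0 : 0 < e x y / 2.
  by rewrite divr_gt0// lt_neqAle pseudometric_ge0 andbT eq_sym; exact/eqP.
exists ([set u | e x u < e x y / 2], [set v | e y v < e x y / 2]) => /=.
  by split; exact: en.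
move=> [u v] /= [xu yv] uv0.
by have := et u x y; have := et v u y; rewrite (es v y); lra.
Qed.

(** A tube lemma: points outside [A] at distances from [x] tending to 0 would cluster at a point of
    the fibre of [x], of which [A] is a neighbourhood. *)
Lemma pseudometric_tube x (A : set X) :
  compact [set: X] -> open A -> (forall w, e x w = 0 -> A w) ->
  exists2 r, 0 < r & forall w, e x w < r -> A w.
Proof.
have [_ es et en] := pe => cX oA xA; apply: contrapT => nr.
have /choice[u uP] (n : nat) : exists w, e x w < harmonic n /\ ~ A w.
  apply: contrapT => nw; apply: nr; exists (harmonic n); first exact: harmonic_gt0.
  move=> w xw.
  by apply: contrapT => Aw; apply: nw; exists w.
have [p clp] := compact_seq_cluster u cX.
suff /xA Ap : e x p = 0.
  by have [n _ /(proj2 (uP n))] := clp A (open_nbhs_nbhs (conj oA Ap)) 0%N.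
apply/eqP; rewrite eq_le pseudometric_ge0 andbT; apply/ler_addgt0Pl => k k0.
have k20 : 0 < k / 2 by rewrite divr_gt0.
have [N _ NP] := harmonic_lt k20.
have [n Nn pn] := clp _ (en p _ k20) N.
move: (NP n Nn) (proj1 (uP n)) pn; have := et (u n) x p; rewrite (es (u n) p).
by move: (harmonic n) => h /=; lra.
Qed.

Section Isometry.
Context {T : X -> X} (eqT : equicontinuous_for T e).
Context (cX : compact [set: X]) (sT : forall y, exists x, T x = y).

(* Applying T^j to two indices i < j at which the backward orbits
   (x_k, y_k), T^k x_k = x, T^k y_k = y, are close shows that T^(j - i)
   almost fixes both x and y. *)
Lemma equicontinuous_recurrence x y k n0 : 0 < k ->
  exists2 n, (n0 <= n)%N & e (iter n T x) x < k /\ e (iter n T y) y < k.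
Proof.
move=> k0; have [_ es et en] := pe; have [d d0 dP] := eqT k0.
have /choice[u uP] n : exists x', iter n T x' = x by exact: iter_surjective.
have /choice[v vP] n : exists y', iter n T y' = y by exact: iter_surjective.
have cXX : compact [set: X * X] by rewrite -setXTT; exact: compact_setX.
have [[p q] clp] := compact_seq_cluster (fun n => (u n, v n)) cXX.
have d20 : 0 < d / 2 by rewrite divr_gt0.
have := clp ([set a | e p a < d / 2] `*` [set b | e q b < d / 2]) _.
move=> /(_ _)/wrap[|clpq].
  by exists ([set a | e p a < d / 2], [set b | e q b < d / 2]) => //=; split; exact: en.
have [i _ [/= pi qi]] := clpq 0%N.
(* Starting from [i + n0] makes the difference [j - i] at least [n0]. *)
have [j ij [/= pj qj]] := clpq (i + n0)%N.
exists (j - i)%N; first by lia.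
have {}ij : (j = (j - i) + i)%N by lia.
split; [rewrite -{1}(uP i) -(uP j)|rewrite -{1}(vP i) -(vP j)].
  rewrite -iterD -ij; apply: dP.
  by have := et p (u i) (u j); rewrite (es _ p); lra.
rewrite -iterD -ij; apply: dP.
by have := et q (v i) (v j); rewrite (es _ q); lra.
Qed.

(** Orbits that come close at time m stay close afterwards, and at some later time both points are
    nearly back where they started. *)
Lemma equicontinuous_distal x y :
  (forall k, 0 < k -> exists n, e (iter n T x) (iter n T y) < k) -> e x y = 0.
Proof.
move=> prox; have [_ es et _] := pe.
apply/eqP; rewrite eq_le pseudometric_ge0 andbT; apply/ler_addgt0Pl => k k0.
have k30 : 0 < k / 3 by rewrite divr_gt0.
have [d d0 dP] := eqT k30; have [m /dP md] := prox d d0.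
have [n mn [nx ny]] := equicontinuous_recurrence x y m k30.
have := md (n - m)%N; rewrite -!iterD subnK// => nxy.
have := et (iter n T x) x y; have := et (iter n T y) (iter n T x) y.
by rewrite (es x (iter n T x)); lra.
Qed.

End Isometry.
End Pseudometric.

(** * Small fibres *)

Section Metric.
Context {R : realType} {X : metricType R}.

Lemma nbhs_mdistP (x : X) (A : set X) :
  nbhs x A <-> exists2 k : R, 0 < k & forall y, mdist x y < k -> A y.
Proof.
split=> [/nbhs_ballP[k /= k0 kA]|[k k0 kA]].
  by exists k => // y xy; apply: kA; rewrite ballEmdist.
by apply/nbhs_ballP; exists k => //= y; rewrite ballEmdist; exact: kA.
Qed.

Lemma pseudometric_mdist : pseudometric (@mdist R X).
Proof.
split=> [x|x y|y x z|x k k0]; first exact: mdistxx.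
- exact: metric_sym.
- exact: metric_triangle.
- by apply/nbhs_mdistP; exists k.
Qed.

Lemma open_nbhs_mdist (U : set X) x : open U -> U x ->
  exists2 k : R, 0 < k & forall y, mdist x y < k -> U y.
Proof. by move=> oU Ux; apply/nbhs_mdistP/open_nbhs_nbhs. Qed.

(* Baire's argument with nested closed balls. *)
Lemma Gdelta_dense_nonempty (S : set X) :
  compact [set: X] -> [set: X] !=set0 -> Gdelta_dense S -> S !=set0.
Proof.
move=> cX [x0 _] [F Fod ->].
have /choice[g gP] (z : nat * (X * R)) : exists s : X * R, 0 < z.2.2 ->
    0 < s.2 /\ forall y, mdist s.1 y <= s.2 -> mdist z.2.1 y <= z.2.2 /\ F z.1 y.
  (* For a radius that is not positive the condition is vacuous. *)
  have [r0|] := boolP (0 < z.2.2); last by exists (x0, 0).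
  have [oF dF] := Fod z.1.
  have oU := open_pseudoball pseudometric_mdist z.2.1 z.2.2.
  have [|y [zy Fy]] := dF _ _ oU; first by exists z.2.1; rewrite /= mdistxx.
  have [k k0 kP] := open_nbhs_mdist (openI oU oF) (conj zy Fy).
  exists (y, k / 2); rewrite /= divr_gt0//; split => // w yw.
  have [|/= zw Fw] := kP w; first by lra.
  by split => //; exact: ltW.
pose s := fix s n := if n is n'.+1 then g (n', s n') else (x0, 1).
have s0 n : 0 < (s n).2.
  by elim: n => [|n IHn] //=; exact: (proj1 (gP (n, s n) IHn)).
have sS n y : mdist (s n.+1).1 y <= (s n.+1).2 -> mdist (s n).1 y <= (s n).2 /\ F n y.
  exact: (proj2 (gP (n, s n) (s0 n))).
have sD n k y : mdist (s (n + k)%N).1 y <= (s (n + k)%N).2 -> mdist (s n).1 y <= (s n).2.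
  elim: k => [|k IHk]; first by rewrite addn0.
  by rewrite addnS => /sS[/IHk].
have [p clp] := compact_seq_cluster (fun n => (s n).1) cX.
exists p => n _; apply: (proj2 (sS n p _)); apply/ler_addgt0Pl => k k0.
have [|m nm /= pm] := clp [set y | mdist p y < k] _ n.+1.
  by apply/nbhs_mdistP; exists k.
have := sD n.+1 (m - n.+1)%N (s m).1; rewrite subnKC// mdistxx => /(_ (ltW (s0 m))).
have := metric_triangle (s n.+1).1 (s m).1 p; rewrite (metric_sym (s m).1 p).
by lra.
Qed.

Section Stability.
Context {T : X -> X} {e : X -> X -> R}.
Context (tdsT : is_tds T) (mT : minimal T).
Context (pe : pseudometric e) (eqT : equicontinuous_for T e).

(** A small pseudoball about [x0] has small diameter. By equicontinuity the images of a small ball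
    about [x] lie inside it whenever the orbit of [x] enters the pseudoball of half the radius,
    which happens syndetically. *)
Lemma frequently_stable_of_singleton_fibre x0 :
  (forall w, e x0 w = 0 -> w = x0) -> frequently_stable T.
Proof.
move=> fib x k k0; have [_ cX cT] := tdsT; have [exx es et en] := pe.
have k20 : 0 < k / 2 by rewrite divr_gt0.
have [|r r0 rP] := pseudometric_tube (x := x0) pe cX
    (open_pseudoball pseudometric_mdist x0 (k / 2)).
  by move=> w /fib -> /=; rewrite mdistxx.
have r20 : 0 < r / 2 by rewrite divr_gt0.
have [d1 d10 d1P] := eqT r20.
have /nbhs_mdistP[d d0 dP] := en x _ d10.
have [|K KP] := minimal_syndetic cX cT mT (open_pseudoball pe x0 (r / 2)).
  by exists x0; rewrite /= exx.
exists d => //; apply: (@upper_density_syndeticC _ _ K) => n.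
have [j jK /= xj] := KP (iter n T x); exists j => //= /lt_geF/negP; apply.
rewrite -iterD addnC in xj.
have close y : ball x d y -> mdist x0 (iter (n + j) T y) < k / 2.
  rewrite ballEmdist => /dP/d1P/(_ (n + j)%N) xy; apply: rP.
  by have := et (iter (n + j) T x) x0 (iter (n + j) T y); lra.
apply: ge_ereal_sup => _ [[_ _] [/= [y xy <-] [z xz <-]] <-] /=.
rewrite lee_fin; move: (close y xy) (close z xz).
have := metric_triangle (iter (n + j) T y) x0 (iter (n + j) T z).
by rewrite (metric_sym _ x0); lra.
Qed.

(** Bounding a whole pseudoball instead of the fibre alone makes the set open. *)
Definition small_fibre (k : R) : set X := [set x | exists2 r, 0 < r &
  forall u w, e x u < r -> e x w < r -> mdist u w < k].

Lemma open_small_fibre k : open (small_fibre k).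
Proof.
have [exx es et en] := pe; rewrite openE => x [r r0 rP].
have r20 : 0 < r / 2 by rewrite divr_gt0.
apply: filterS (en x _ r20) => y /= xy; exists (r / 2) => // u w yu yw.
by apply: rP; [have := et y x u|have := et y x w]; lra.
Qed.

Lemma small_fibreP k x : (forall w, e x w = 0 -> mdist x w < k) ->
  small_fibre (k + k) x.
Proof.
have [_ cX _] := tdsT.
move=> /(pseudometric_tube pe cX (open_pseudoball pseudometric_mdist x k))[r r0 rP].
exists r => // u w /rP /= xu /rP /= xw.
by have := metric_triangle u x w; rewrite (metric_sym u x); lra.
Qed.

Lemma small_fibre_mdist k x w : small_fibre k x -> e x w = 0 -> mdist x w < k.
Proof.
by have [exx _ _ _] := pe; move=> [r r0 rP] xw; apply: rP; rewrite ?exx ?xw.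
Qed.

Lemma iter_unif_continuous n k : 0 < k ->
  exists2 d, 0 < d & forall x y, mdist x y < d -> forall j, (j <= n)%N ->
    mdist (iter j T x) (iter j T y) < k.
Proof.
have [_ cX cT] := tdsT; move=> k0.
have unif j : exists2 d, 0 < d & forall x y, mdist x y < d ->
    mdist (iter j T x) (iter j T y) < k.
  apply: contrapT => nd.
  have /choice[u uP] (i : nat) : exists p : X * X, mdist p.1 p.2 < harmonic i /\
      ~ mdist (iter j T p.1) (iter j T p.2) < k.
    apply: contrapT => np; apply: nd; exists (harmonic i).
      exact: harmonic_gt0.
    by move=> x y xy; apply: contrapT => nxy; apply: np; exists (x, y).
  have [p clp] := compact_seq_cluster (fun i => (u i).1) cX.
  have k20 : 0 < k / 2 by rewrite divr_gt0.
  have /nbhs_mdistP[d d0 dP] : nbhs p (iter j T @^-1`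
      [set y | mdist (iter j T p) y < k / 2]).
    by apply: iter_continuous => //; apply/nbhs_mdistP; exists (k / 2).
  have d20 : 0 < d / 2 by rewrite divr_gt0.
  have [N _ NP] := harmonic_lt d20.
  have [|i Ni /= pi] := clp [set y | mdist p y < d / 2] _ N.
    by apply/nbhs_mdistP; exists (d / 2).
  have [ui] := uP i; apply.
  have hi : harmonic i < d / 2 by exact: NP.
  have /dP /= p1 : mdist p (u i).1 < d by lra.
  have /dP /= p2 : mdist p (u i).2 < d.
    have := metric_triangle p (u i).1 (u i).2.
    by move: (harmonic i) ui hi => h; lra.
  have := metric_triangle (iter j T (u i).1) (iter j T p) (iter j T (u i).2).
  by rewrite (metric_sym _ (iter j T p)); lra.
elim: n => [|n [d d0 dP]].
  by exists k => // x y xy j; rewrite leqn0 => /eqP ->.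
have [d' d'0 d'P] := unif n.+1; exists (Num.min d d').
  by rewrite lt_min d0.
move=> x y; rewrite lt_min => /andP[xy xy'] j.
by rewrite leq_eqVlt => /predU1P[->|]; [exact: d'P|rewrite ltnS; exact: dP].
Qed.

(* Fibres are mapped onto fibres, since e is a distal pseudometric; hence a
   point with a small fibre can be moved anywhere in bounded time. *)
Lemma dense_small_fibre k : 0 < k ->
  (forall k, 0 < k -> small_fibre k !=set0) -> dense (small_fibre k).
Proof.
move=> k0 sm U U0 oU; have [_ cX cT] := tdsT.
have sT := minimal_surjective (@metric_hausdorff _ X) tdsT mT.
have k20 : 0 < k / 2 by rewrite divr_gt0.
have [K KP] := minimal_syndetic cX cT mT oU U0.
have [d d0 dP] := iter_unif_continuous K k20.
have [x xd] := sm d d0; have [j jK Uj] := KP x.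
exists (iter j T x); split => //; rewrite (splitr k); apply: small_fibreP => w.
have [y <-] := iter_surjective j sT w => xy0.
apply: dP => //; apply: (small_fibre_mdist xd).
(* The images of [x] and [y] at time j are at distance 0, so distality puts [y] in the fibre of
   [x]. *)
apply: (equicontinuous_distal pe eqT cX sT) => h h0.
by exists j; rewrite xy0.
Qed.

End Stability.
End Metric.

(** * The visit pseudometric of an open set *)

Section VisitFrequency.
Context {R : realType} {X : metricType R} {T : X -> X}.
Context (tdsT : is_tds T) (mT : minimal T).
Context {m : set nat -> R}.
Context (mS : forall F G, F `<=` G -> m F <= m G).
Context (mUI : forall F G, m (F `|` G) + m (F `&` G) = m F + m G).
Context (m_succ : forall F, m (succn @` F) = m F) (m0 : m set0 = 0).
Context (U : set X).

(** The margin [k] is what makes the regularised frequency upper semicontinuous. *)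
Definition visits (k : R) (P : set X) : set nat :=
  [set i | exists u y, [/\ U u, P y & mdist y (iter i T u) < k]].

(* Outer regularisation of the frequency of the times i at which T^i U meets P. *)
Definition visit_freq (P : set X) : R :=
  inf [set m (visits k P) | k in [set k | 0 < k]].

Lemma visitsS k k' P Q : k <= k' -> P `<=` Q -> visits k P `<=` visits k' Q.
Proof.
move=> kk' PQ i [u [y [Uu Py yu]]]; exists u, y.
by split => //; [exact: PQ|exact: lt_le_trans kk'].
Qed.

Lemma mean_ge0 F : 0 <= m F.
Proof. by rewrite -m0; exact: mS. Qed.

Lemma mean_le_add F G : m (F `|` G) <= m F + m G.
Proof. by rewrite -mUI lerDl mean_ge0. Qed.

Lemma mean_setD F G : m (F `\` G) = m (F `|` G) - m G.
Proof.
have := mUI (F `\` G) G.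
by rewrite setDKI m0 addr0 setUDl setDv setD0 => ->; rewrite addrK.
Qed.

Lemma has_inf_visits P : has_inf [set m (visits k P) | k in [set k | 0 < k]].
Proof.
split; last by exists 0 => _ [k' _ <-]; exact: mean_ge0.
by exists (m (visits 1 P)), 1; rewrite //= ltr01.
Qed.

Lemma visit_freq_le k P : 0 < k -> visit_freq P <= m (visits k P).
Proof.
move=> k0; apply: ge_inf; last by exists k.
exact: (proj2 (has_inf_visits P)).
Qed.

(** By monotonicity the bound persists for smaller margins, so several sets can share one margin. *)
Lemma visit_freq_adherent P h : 0 < h ->
  exists2 k, 0 < k & forall k', 0 < k' <= k -> m (visits k' P) < visit_freq P + h.
Proof.
move=> h0; have [_ [k k0 <-] kh] := inf_adherent h0 (has_inf_visits P).
exists k => // k' /andP[k'0 k'k]; apply: le_lt_trans kh.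
by apply: mS; apply: visitsS.
Qed.

Lemma visits_succ k k' x : (forall y, mdist x y < k -> mdist (T x) (T y) < k') ->
  succn @` visits k [set x] `<=` visits k' [set T x].
Proof.
by move=> kk' _ [i [u [_ [Uu -> xu]]] <-]; exists u, (T x); split => //=; exact: kk'.
Qed.

Lemma visits_ball k x y : mdist x y < k ->
  visits k [set x; y] `<=` visits (k + k) [set x].
Proof.
move=> xy i [u [z [Uu xyz zu]]]; exists u, x; split => //.
have := metric_triangle x z (iter i T u).
by case: xyz zu => -> zu; rewrite ?mdistxx; move: zu; have := mdist_ge0 x y; lra.
Qed.

Lemma visit_freqS P Q : P `<=` Q -> visit_freq P <= visit_freq Q.
Proof.
move=> PQ; apply/ler_addgt0Pr => h h0; have [k k0 kP] := visit_freq_adherent Q h0.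
apply: le_trans (visit_freq_le P k0) _; apply: le_trans (ltW (kP k _)).
  by apply: mS; apply: visitsS.
by rewrite k0 lexx.
Qed.

(** Serves twice: for the upper semicontinuity of the point frequency and for the continuity of
    [visit_dist]. *)
Lemma visit_freq_near x h : 0 < h -> exists2 k, 0 < k &
  forall y, mdist x y < k -> visit_freq [set x; y] < visit_freq [set x] + h.
Proof.
move=> h0; have [k k0 kP] := visit_freq_adherent [set x] h0.
have k20 : 0 < k / 2 by rewrite divr_gt0.
exists (k / 2) => // y xy; apply: le_lt_trans (visit_freq_le _ k20) _.
apply: le_lt_trans (kP k _); last by rewrite k0 lexx.
by rewrite [X in visits X [set x]](splitr k); apply: mS; exact: visits_ball.
Qed.

(* The function is upper semicontinuous and does not decrease along orbits, so
   its superlevel sets are closed and invariant. *)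
Lemma visit_freq_const x y : visit_freq [set x] = visit_freq [set y].
Proof.
have [_ _ cT] := tdsT.
suff le x' y' : visit_freq [set y'] <= visit_freq [set x'].
  by apply/eqP; rewrite eq_le !le.
have : [set z | visit_freq [set y'] <= visit_freq [set z]] = setT.
  apply: mT; last 1 first.
  - move=> _ [z /= yz <-]; apply: le_trans yz _.
    apply/ler_addgt0Pr => h h0.
    have [k k0 kP] := visit_freq_adherent [set T z] h0.
    have /nbhs_mdistP[d d0 dP] : nbhs z (T @^-1` [set w | mdist (T z) w < k]).
      by apply: cT; apply/nbhs_mdistP; exists k.
    apply: le_trans (visit_freq_le _ d0) _; rewrite -m_succ.
    apply: le_trans (ltW (kP k _)); last by rewrite k0 lexx.
    by apply: mS; exact: visits_succ.
  - rewrite -[X in closed X]setCK; apply: open_closedC; rewrite openE => z /= /negP.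
    rewrite -ltNge => zy; apply/nbhs_mdistP.
    have [|k k0 kP] := @visit_freq_near z (visit_freq [set y'] - visit_freq [set z]).
      by rewrite subr_gt0.
    exists k => // w zw; apply/negP; rewrite -ltNge.
    have : visit_freq [set w] <= visit_freq [set z; w] by apply: visit_freqS => _ ->; right.
    by have := kP w zw; lra.
  - by exists y' => /=.
by move/seteqP => [_ /(_ x' I)].
Qed.

(** For a fixed margin the corresponding difference is the frequency of the visits to [y] that are
    not visits to [x]. *)
Definition visit_dist (x y : X) : R := visit_freq [set x; y] - visit_freq [set x].

Lemma visit_dist_pseudometric : pseudometric visit_dist.
Proof.
rewrite /visit_dist; split.
- by move=> x; rewrite setUid subrr.
- by move=> x y; rewrite setUC (visit_freq_const x y).
- move=> y x z; rewrite (visit_freq_const y x).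
  (* Strong subadditivity: the union of the visits to the pairs containing [y] covers the visits to
     [x] or [z], and their intersection contains the visits to [y]. *)
  suff : visit_freq [set x; z] + visit_freq [set x] <=
      visit_freq [set x; y] + visit_freq [set y; z] by lra.
  apply/ler_addgt0Pr => h h0; have h20 : 0 < h / 2 by rewrite divr_gt0.
  have [k k0 kP] := visit_freq_adherent [set x; y] h20.
  have [k' k'0 k'P] := visit_freq_adherent [set y; z] h20.
  pose l := Num.min k k'; have l0 : 0 < l by rewrite lt_min k0.
  have [lk lk'] : l <= k /\ l <= k' by rewrite !ge_min !lexx orbT.
  have := kP l; rewrite l0 lk => /(_ isT) xyl.
  have := k'P l; rewrite l0 lk' => /(_ isT) yzl.
  have := mUI (visits l [set x; y]) (visits l [set y; z]).
  have : visit_freq [set x; z] <= m (visits l [set x; y] `|` visits l [set y; z]).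
    apply: le_trans (visit_freq_le _ l0) _; apply: mS => i [u [w [Uu [] -> wu]]].
      by left; exists u, x; split => //; left.
    by right; exists u, z; split => //; right.
  have : visit_freq [set x] <= m (visits l [set x; y] `&` visits l [set y; z]).
    rewrite (visit_freq_const x y).
    apply: le_trans (visit_freq_le _ l0) _; apply: mS => i [u [_ [Uu -> wu]]].
    by split; exists u, y; split => //; [right|left].
  by lra.
- move=> x h h0; have [k k0 kP] := visit_freq_near x h0.
  by apply/nbhs_mdistP; exists k => // y /kP /=; lra.
Qed.

Lemma visit_dist_le1 x y : m setT = 1 -> visit_dist x y <= 1.
Proof.
move=> m1; have : visit_freq [set x; y] <= 1.
  by rewrite -m1; apply: le_trans (visit_freq_le _ ltr01) _; exact: mS.
have : 0 <= visit_freq [set x].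
  apply: lb_le_inf; first exact: (proj1 (has_inf_visits _)).
  by move=> _ [k _ <-]; exact: mean_ge0.
by rewrite /visit_dist; lra.
Qed.

(* Up to small frequency the visits to Tx are the successors of the visits to
   x, because the two sets are nested and have nearly equal frequencies. *)
Lemma visit_dist_nonexpansive x y : visit_dist (T x) (T y) <= visit_dist x y.
Proof.
have [_ _ cT] := tdsT.
rewrite /visit_dist (visit_freq_const (T x) x) lerD2r.
apply/ler_addgt0Pr => h h0; have h30 : 0 < h / 3 by rewrite divr_gt0.
have [k k0 kP] := visit_freq_adherent [set x; y] h30.
have [kx kx0 kxP] := visit_freq_adherent [set T x] h30.
have [ky ky0 kyP] := visit_freq_adherent [set T y] h30.
pose l := Num.min kx ky; have l0 : 0 < l by rewrite lt_min kx0.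
have [lx ly] : l <= kx /\ l <= ky by rewrite !ge_min !lexx orbT.
have := kxP l; rewrite l0 lx => /(_ isT) {}kxP.
have := kyP l; rewrite l0 ly => /(_ isT) {}kyP.
have near z : exists2 d, 0 < d & forall w, mdist z w < d -> mdist (T z) (T w) < l.
  apply: (proj1 (nbhs_mdistP z (T @^-1` [set w | mdist (T z) w < l]))).
  by apply: cT; apply/nbhs_mdistP; exists l.
have [dx dx0 dxP] := near x; have [dy dy0 dyP] := near y.
pose d := Num.min k (Num.min dx dy).
have d0 : 0 < d by rewrite !lt_min k0 dx0.
have [dk ddx ddy] : [/\ d <= k, d <= dx & d <= dy] by rewrite !ge_min !lexx !orbT.
have := kP d; rewrite d0 dk => /(_ isT) {}kP.
have sx : succn @` visits d [set x] `<=` visits l [set T x].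
  by apply: visits_succ => w xw; apply: dxP; exact: lt_le_trans xw ddx.
have sy : succn @` visits d [set y] `<=` visits l [set T y].
  by apply: visits_succ => w yw; apply: dyP; exact: lt_le_trans yw ddy.
(* The visits to Tx and Ty not accounted for by the preceding time; each set costs h/3, and the last
   third is the margin error for the pair. *)
pose Dx := visits l [set T x] `\` succn @` visits d [set x].
pose Dy := visits l [set T y] `\` succn @` visits d [set y].
have mDx : m Dx < h / 3.
  rewrite mean_setD (setUidl sx) m_succ.
  by have := visit_freq_le [set x] d0; rewrite (visit_freq_const x (T x)); lra.
have mDy : m Dy < h / 3.
  rewrite mean_setD (setUidl sy) m_succ.
  by have := visit_freq_le [set y] d0; rewrite (visit_freq_const y (T y)); lra.
have : visit_freq [set T x; T y] <= m (succn @` visits d [set x; y] `|` (Dx `|` Dy)).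
  apply: le_trans (visit_freq_le _ l0) _; apply: mS => i [u [_ [Uu [] -> wu]]].
    have [[j [u' [w [Uu' -> wu']]] <-]|ni] := pselect ((succn @` visits d [set x]) i).
      by left; exists j => //; exists u', x; split => //; left.
    by right; left; split => //; exists u, (T x).
  have [[j [u' [w [Uu' -> wu']]] <-]|ni] := pselect ((succn @` visits d [set y]) i).
    by left; exists j => //; exists u', y; split => //; right.
  by right; right; split => //; exists u, (T y).
have := mean_le_add (succn @` visits d [set x; y]) (Dx `|` Dy).
have := mean_le_add Dx Dy; rewrite m_succ; lra.
Qed.

(* Every T^i U contains one of the points T^j x0 with j <= K, K being a bound
   for the return times to U. If none of them had a small fibre, at each time i
   when T^i U has diameter at most k it would contain some T^j x0 while staying
   away from a point z_j of the same fibre; nearby visits to T^j x0 without a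
   visit to z_j are arbitrarily rare. *)
Lemma visit_dist_small_fibre k : 0 < k -> open U -> U !=set0 ->
  0 < m [set i | ~ (k%:E < diam (iter i T @` U))%E] ->
  exists x, forall z, visit_dist x z = 0 -> mdist x z < 3 * k.
Proof.
set G := [set i | _] => k0 oU U0 mG; have [[x0 _] cX cT] := tdsT.
have sT := minimal_surjective (@metric_hausdorff _ X) tdsT mT.
have [K KP] := minimal_syndetic cX cT mT oU U0.
apply: contrapT => nx.
have /choice[z zP] j : exists z, visit_dist (iter j T x0) z = 0 /\
    3 * k <= mdist (iter j T x0) z.
  apply: contrapT => nz; apply: nx; exists (iter j T x0) => z z0.
  by rewrite ltNge; apply/negP => kz; apply: nz; exists z.
(* The K+1 sets below, each of mean less than h, will cover [G], so a total of (K+2)h is out of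
   reach. *)
have [h hE] : exists h, h * K.+2%:R = m G.
  by exists (m G / K.+2%:R); rewrite mulfVK// pnatr_eq0.
have h0 : 0 < h by rewrite -(pmulr_lgt0 _ (ltr0Sn R K.+1)) hE.
pose A l j := visits l [set iter j T x0] `\` visits l [set z j].
have /choice[l lP] j : exists l, 0 < l <= k /\ m (A l j) < h.
  have [l l0 lP] := visit_freq_adherent [set iter j T x0; z j] h0.
  exists (Num.min l k); rewrite lt_min l0 k0 ge_min lexx orbT; split => //.
  rewrite mean_setD.
  have -> : visits (Num.min l k) [set iter j T x0] `|` visits (Num.min l k) [set z j] =
      visits (Num.min l k) [set iter j T x0; z j].
    apply/seteqP; split => i.
      by move=> [] [u [w [Uu -> wu]]]; [exists u, (iter j T x0)|exists u, (z j)];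
        split => //; [left|right].
    by move=> [u [w [Uu [] -> wu]]]; [left|right]; [exists u, (iter j T x0)|exists u, (z j)].
  (* Since [visit_dist] vanishes on the pair, the pair is visited hardly more often than [z j]
     alone. *)
  have := lP (Num.min l k); rewrite lt_min l0 k0 ge_min lexx => /(_ isT).
  have lk0 : 0 < Num.min l k by rewrite lt_min l0.
  have := visit_freq_le [set z j] lk0; rewrite (visit_freq_const (z j) (iter j T x0)).
  by have := proj1 (zP j); rewrite /visit_dist; lra.
have cover : G `<=` \bigcup_(j in [set j | (j < K.+1)%N]) A (l j) j.
  (* Pulling [x0] back by i steps before moving it into [U] yields a point of [U] that is at
     [iter j T x0] at time i. *)
  move=> i Gi; have [x xi] := iter_surjective i sT x0.
  have [j jK Uj] := KP x; exists j => //.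
  have ji : iter i T (iter j T x) = iter j T x0 by rewrite -xi -!iterD addnC.
  have [/andP[l0 lk] _] := lP j; split.
    by exists (iter j T x), (iter j T x0); rewrite ji mdistxx.
  move=> [u [w [Uu -> zu]]]; apply: Gi; apply: (@lt_le_trans _ _
    (mdist (iter j T x0) (iter i T u))%:E).
    (* A visit to [z j] comes within k of it, hence stays more than 2k away from [iter j T x0]. *)
    rewrite lte_fin; have := proj2 (zP j).
    have := metric_triangle (iter j T x0) (iter i T u) (z j).
    by rewrite (metric_sym (iter i T u) (z j)); lra.
  apply: ereal_sup_ubound; exists (iter j T x0, iter i T u) => //=.
  by split; [exists (iter j T x)|exists u].
have sum n : m (\bigcup_(j in [set j | (j < n)%N]) A (l j) j) <=
    n%:R * h.
  elim: n => [|n IHn].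
    by rewrite mul0r (_ : \bigcup_(j in _) _ = set0) ?m0//; apply/seteqP; split => // i [].
  apply: (@le_trans _ _ (m ((\bigcup_(j in [set j | (j < n)%N]) A (l j) j) `|` A (l n) n))).
    apply: mS => i [j /=]; rewrite ltnS leq_eqVlt => /predU1P[->|jn] Aj; first by right.
    by left; exists j.
  apply: le_trans (mean_le_add _ _) _; rewrite -natr1 mulrDl mul1r.
  by apply: lerD => //; exact: ltW (proj2 (lP n)).
have := le_trans (mS cover) (sum K.+1).
by rewrite -hE mulrC ler_pM2r// ler_nat ltnn.
Qed.

End VisitFrequency.

(** * Equicontinuous quotients *)

Section SupPseudometric.
Context {R : realType} {X : topologicalType} (rho : nat -> X -> X -> R).
Context (prho : forall n, pseudometric (rho n)) (rho1 : forall n x y, rho n x y <= 1).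

(** The weights tend to 0, which keeps the supremum continuous, and are positive, so that its fibres
    are the common fibres of all [rho n]. *)
Definition sup_pseudometric (x y : X) : R :=
  sup (range (fun n => rho n x y * harmonic n)).

Let harmonic_pos n : 0 < harmonic n :> R := harmonic_gt0 n.

Lemma sup_pseudometric_ge n x y : rho n x y * harmonic n <= sup_pseudometric x y.
Proof.
apply: ub_le_sup; last by exists n.
exists 1 => _ [i _ <-]; apply: mulr_ile1 => //.
- exact: pseudometric_ge0.
- by rewrite ltW.
- by rewrite /harmonic invf_le1 ?ltr0n// ler1n.
Qed.

Lemma sup_pseudometric_le x y b :
  (forall n, rho n x y * harmonic n <= b) -> sup_pseudometric x y <= b.
Proof.
move=> nb; apply: ge_sup; first by exists (rho 0%N x y * harmonic 0%N), 0%N.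
by move=> _ [n _ <-].
Qed.

Lemma sup_pseudometric_eq0 x y n : sup_pseudometric x y = 0 -> rho n x y = 0.
Proof.
move=> xy0; have := sup_pseudometric_ge n x y; rewrite xy0 pmulr_lle0// => xy.
by apply/eqP; rewrite eq_le xy pseudometric_ge0.
Qed.

Lemma sup_pseudometricP : pseudometric sup_pseudometric.
Proof.
split.
- move=> x; apply/eqP; rewrite eq_le; apply/andP; split.
    by apply: sup_pseudometric_le => n; have [-> _ _ _] := prho n; rewrite mul0r.
  apply: le_trans _ (sup_pseudometric_ge 0%N x x).
  by have [-> _ _ _] := prho 0%N; rewrite mul0r.
- move=> x y; rewrite /sup_pseudometric.
  have -> // : (fun n => rho n x y * harmonic n) = (fun n => rho n y x * harmonic n).
  apply/funext => n; by have [_ -> _ _] := prho n.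
- move=> y x z; apply: sup_pseudometric_le => n; have [_ _ et _] := prho n.
  apply: le_trans _ (lerD (sup_pseudometric_ge n x y) (sup_pseudometric_ge n y z)).
  by rewrite -mulrDl ler_pM2r.
- move=> x k k0; have k20 : 0 < k / 2 by rewrite divr_gt0.
  (* From N on the weights alone give the bound; only finitely many indices need continuity. *)
  have [N _ NP] := harmonic_lt k20.
  have : \forall y \near x, forall n, (n < N)%N -> rho n x y < k / 2.
    elim: N {NP} => [|N IHN]; first by apply: nearW.
    have [_ _ _ en] := prho N; apply: filterS2 IHN (en x _ k20) => y IH xy n.
    by rewrite ltnS leq_eqVlt => /predU1P[->|/IH].
  apply: filterS => y xy /=; apply: (@le_lt_trans _ _ (k / 2)); last by lra.
  apply: sup_pseudometric_le => n; have [nN|Nn] := ltnP n N.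
    apply: le_trans (ltW (xy n nN)); rewrite ler_piMr ?pseudometric_ge0//.
    by rewrite /harmonic invf_le1 ?ltr0n// ler1n.
  apply: le_trans (ltW (NP n Nn)); rewrite ler_piMl//.
  by rewrite ltW.
Qed.

Lemma sup_pseudometric_nonexpansive (T : X -> X) :
  (forall n x y, rho n (T x) (T y) <= rho n x y) ->
  forall x y, sup_pseudometric (T x) (T y) <= sup_pseudometric x y.
Proof.
move=> rT x y; apply: sup_pseudometric_le => n.
by apply: le_trans (sup_pseudometric_ge n x y); rewrite ler_pM2r.
Qed.

End SupPseudometric.

Lemma nonexpansive_equicontinuous (R : realType) (X : topologicalType)
    (T : X -> X) (e : X -> X -> R) :
  (forall x y, e (T x) (T y) <= e x y) -> equicontinuous_for T e.
Proof.
move=> eT k k0; exists k => // x y xy n; apply: le_lt_trans xy.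
by elim: n => //= n; apply: le_trans.
Qed.

Section Quotient.
Context {R : realType} {X : topologicalType} {T : X -> X}.

Lemma quot_piP (E : equiv_rel X) x y : quot_pi E x = quot_pi E y <-> E x y.
Proof. by split => [/eqmodP|xy]; last exact/eqmodP. Qed.

Lemma quot_piK (E : equiv_rel X) (q : quot E) : quot_pi E (repr (q : {eq_quot E})) = q.
Proof. exact: reprK. Qed.

Lemma iter_quot_map (E : equiv_rel X) n x :
  (forall x y, E x y -> E (T x) (T y)) ->
  iter n (@quot_map X E T) (quot_pi E x) = quot_pi E (iter n T x).
Proof. by move=> ET; elim: n => //= n ->; rewrite quot_mapE. Qed.

(** The pseudometric descends to a metric on its classes. Compactness, through the tube lemma, shows
    that this metric induces the quotient topology. *)
Lemma pseudometric_quotient (e : X -> X -> R) :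
  compact [set: X] -> pseudometric e -> (forall x y, e (T x) (T y) <= e x y) ->
  exists2 E : equiv_rel X, equicontinuous_quotient R T E &
    forall x y, E x y <-> e x y = 0.
Proof.
move=> cX pe eT; have [exx es et en] := pe.
pose r : rel X := fun x y => e x y == 0.
have rr : reflexive r by move=> x; apply/eqP.
have rs : symmetric r by move=> x y; rewrite /r es.
have rt : transitive r.
  move=> y x z /eqP xy /eqP yz; apply/eqP/le_anti.
  by rewrite (pseudometric_ge0 pe) andbT; have := et y x z; rewrite xy yz addr0.
pose E := EquivRel r rr rs rt.
have EP x y : E x y <-> e x y = 0 by split => /eqP.
have e_congr x x' y y' : E x x' -> E y y' -> e x y = e x' y'.
  move=> /EP xx' /EP yy'; have := et x' x y; have := et y' x' y; have := et x x' y'.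
  have := et y x y'; rewrite (es x' x) (es y' y) xx' yy'; lra.
have ET x y : E x y -> E (T x) (T y).
  move=> /EP xy; apply/EP/le_anti; rewrite (pseudometric_ge0 pe) andbT -xy.
  exact: eT.
have reprE x : E (repr (quot_pi E x : {eq_quot E})) x.
  by apply/quot_piP; rewrite quot_piK.
exists E => //; split.
  split => //; have := closed_pseudometric_eq0 pe; congr closed.
  by apply/seteqP; split => -[x y] /= /EP.
pose d (p q : quot E) := e (repr (p : {eq_quot E})) (repr (q : {eq_quot E})).
have dE x y : d (quot_pi E x) (quot_pi E y) = e x y by exact: e_congr.
exists d; last first.
  move=> k /(nonexpansive_equicontinuous eT)[l l0 lP]; exists l => // p q.
  rewrite -(quot_piK p) -(quot_piK q) dE => /lP pq n.
  by rewrite !iter_quot_map// dE.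
split.
- move=> p q; rewrite -(quot_piK p) -(quot_piK q) dE -EP.
  by split=> /quot_piP.
- by move=> p q; exact: es.
- by move=> p q s; exact: et.
- move=> p A; rewrite -(quot_piK p); move: (repr _) => x; split.
    rewrite nbhsE => -[B [oB Bx] BA].
    have oB' : open (quot_pi E @^-1` B) by [].
    have [|k k0 kP] := pseudometric_tube (x := x) pe cX oB'.
      by move=> w /EP/quot_piP; rewrite /preimage /= => <-.
    exists k => // q; rewrite /= -(quot_piK q) dE => xq; apply: BA; exact: kP.
  move=> [k k0 kA]; rewrite nbhsE.
  exists [set q | d (quot_pi E x) q < k] => //; split; last by rewrite /= dE exx.
  have := open_pseudoball pe x k.
  rewrite [X in open X -> _](_ : _ = quot_pi E @^-1` [set q | d (quot_pi E x) q < k]) //.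
  by apply/seteqP; split => y /=; rewrite dE.
Qed.

(** Pulling back the metric of an equicontinuous factor makes the distality lemma applicable on
    X. *)
Lemma quotient_pseudometric (E : equiv_rel X) :
  equicontinuous_quotient R T E -> exists e : X -> X -> R,
    [/\ pseudometric e, equicontinuous_for T e & forall x y, E x y <-> e x y = 0].
Proof.
move=> [[_ ET] [d [d0 ds dt dn] dT]].
exists (fun x y => d (quot_pi E x) (quot_pi E y)); split.
- split => [x|x y|y x z|x k k0]; [exact/d0|exact: ds|exact: dt|].
  have : nbhs (quot_pi E x) [set q | d (quot_pi E x) q < k] by apply/dn; exists k.
  by move/(@pi_continuous _ {eq_quot E} x).
- move=> k /dT[l l0 lP]; exists l => // x y xy n.
  by rewrite -!iter_quot_map//; exact: lP.
- by move=> x y; rewrite d0 quot_piP.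
Qed.

End Quotient.

(** * The two implications *)

Section AlmostAutomorphic.
Context {R : realType} {X : metricType R} {T : X -> X}.
Context (tdsT : is_tds T) (mT : minimal T).

Lemma almost_automorphic_frequently_stable :
  almost_automorphic R T -> frequently_stable T.
Proof.
move=> [E [Eeq _] a11]; have [e [pe eqT EP]] := quotient_pseudometric Eeq.
have [X0 cX _] := tdsT.
have [x0 x0P] := Gdelta_dense_nonempty cX X0 a11.
apply: (frequently_stable_of_singleton_fibre tdsT mT pe eqT (x0 := x0)) => w.
move=> /EP/quot_piP x0w; move/seteqP: x0P => [+ _]; apply.
by rewrite /= -x0w.
Qed.

Lemma almost_automorphic_of_small_fibre (e : X -> X -> R) :
  pseudometric e -> (forall x y, e (T x) (T y) <= e x y) ->
  (forall k, 0 < k -> small_fibre (e := e) k !=set0) -> almost_automorphic R T.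
Proof.
move=> pe eT sm; have [X0 cX cT] := tdsT; have [exx _ et _] := pe.
have sT := minimal_surjective (@metric_hausdorff _ X) tdsT mT.
have eqT := nonexpansive_equicontinuous eT.
have [E Eeq EP] := pseudometric_quotient cX pe eT.
have harmonic_pos n : 0 < harmonic n :> R := harmonic_gt0 n.
have a11 : almost_one_to_one (quot_pi E).
  (* A point lies in all these sets exactly when its fibre is a singleton. *)
  exists (fun n => small_fibre (e := e) (harmonic n)).
    move=> n; split; first exact: open_small_fibre.
    exact: dense_small_fibre.
  apply/seteqP; split => x.
    move=> /= fx n _.
    suff: small_fibre (e := e) (harmonic n / 2 + harmonic n / 2) x by rewrite -splitr.
    apply: (small_fibreP tdsT pe) => w /EP/quot_piP xw.
    have -> : w = x by move/seteqP: fx => [+ _]; apply; rewrite /= -xw.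
    by rewrite mdistxx divr_gt0.
  move=> xP; apply/seteqP; split => w; last by move=> ->.
  rewrite /= => /esym/quot_piP/EP xw; apply/esym/mdist_positivity/le_anti.
  rewrite mdist_ge0 andbT; apply/ler_addgt0Pl => k k0.
  have [n _ /(_ n (leqnn n)) nk] := harmonic_lt k0.
  by rewrite addr0 ltW//; apply: lt_trans nk; exact: (small_fibre_mdist pe (xP n I)).
(* Maximality: the orbits of two points of one fibre approach together a point [x0] with singleton
   fibre, so they are proximal for [e'], and distality of [e'] identifies them. *)
exists E => //; split => // E' /quotient_pseudometric[e' [pe' eqT' EP']] x y /EP xy.
apply/EP'; apply: (equicontinuous_distal pe' eqT' cX sT) => k k0.
have [x0 x0P] := Gdelta_dense_nonempty cX X0 a11.
have [e'xx e's e't _] := pe'; have k20 : 0 < k / 2 by rewrite divr_gt0.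
have [|r r0 rP] := pseudometric_tube (x := x0) pe cX (open_pseudoball pe' x0 (k / 2)).
  move=> w /EP/quot_piP x0w; have -> : w = x0.
    by move/seteqP: x0P => [+ _]; apply; rewrite /= -x0w.
  by rewrite /= e'xx.
have [|n x0n] := minimal_orbit x cT mT (open_pseudoball pe x0 r).
  by exists x0; rewrite /= exx.
have exy : e (iter n T x) (iter n T y) = 0.
  apply/le_anti; rewrite (pseudometric_ge0 pe) andbT -xy.
  by elim: n {x0n} => //= n; apply: le_trans.
exists n; have := rP _ x0n; have := rP (iter n T y).
have := et (iter n T x) x0 (iter n T y); rewrite exy addr0 => /le_lt_trans/(_ x0n).
move=> x0y /(_ x0y) /= yn xn; have := e't x0 (iter n T x) (iter n T y).
by rewrite (e's _ x0); lra.
Qed.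

Lemma frequently_stable_almost_automorphic :
  frequently_stable T -> almost_automorphic R T.
Proof.
move=> fs; have [[x0 X0] cX cT] := tdsT.
have [m [mS mUI m_succ [m0 m1] m_lt1]] := @invariant_mean R.
have /choice[d dP] (n : nat) : exists d : R, 0 < d /\ (upper_density R
    [set i | (harmonic n)%:E < diam (iter i T @` ball x0 d)] < 1)%E.
  have [|d d0 ud] := fs x0 (harmonic n); first exact: harmonic_gt0.
  by exists d.
pose rho n := visit_dist (T := T) (m := m) (ball x0 (d n)).
have prho n : pseudometric (rho n) by exact: visit_dist_pseudometric.
have rho1 n x y : rho n x y <= 1 by exact: visit_dist_le1.
apply: (@almost_automorphic_of_small_fibre (sup_pseudometric rho)).
- exact: sup_pseudometricP.
- by apply: sup_pseudometric_nonexpansive => // n x y; exact: visit_dist_nonexpansive.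
(* The fibre bound is 3 times [harmonic n], and [small_fibreP] doubles it: hence k/6. *)
move=> k k0; have k60 : 0 < k / 6 by rewrite divr_gt0.
have [n _ /(_ n (leqnn n)) nk] := harmonic_lt k60.
have [dn0 /m_lt1] := dP n; set B := [set i | _] => mB.
have [||||x xP] := visit_dist_small_fibre tdsT mT mS mUI m_succ m0
  (U := ball x0 (d n)) (k := harmonic n).
- exact: harmonic_gt0.
- rewrite ballEmdist; exact: (open_pseudoball pseudometric_mdist).
- by exists x0; rewrite ballEmdist /= mdistxx.
(* The unstable times have mean below 1, so their complement has positive mean. *)
- have := mUI B (~` B); rewrite setUv setICr m0 m1.
  by rewrite -[[set i | _]]/(~` B); lra.
exists x; rewrite [k]splitr; apply: (small_fibreP tdsT (sup_pseudometricP prho rho1)).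
move=> w /(sup_pseudometric_eq0 prho rho1 n)/xP.
by move: (harmonic n) nk => h; lra.
Qed.

End AlmostAutomorphic.

Theorem theorem1p1 (R : realType) (X : metricType R) (T : X -> X) :
  is_tds T -> minimal T ->
  (frequently_stable T <-> almost_automorphic R T).
Proof.
move=> tdsT mT; split.
  exact: frequently_stable_almost_automorphic.
exact: almost_automorphic_frequently_stable.
Qed.
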